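(* Let $p$ be an odd prime and let $G$ be a finite noncyclic group of nilpotency class at most two and exponent $p$. Let $g_1,\ldots,g_n$ be elements of $G$ that project onto a basis for $G^{\rm ab}$, and let $F$ be the $3$-nilpotent product of $n$ cyclic groups of order $p$ generated by $x_1,\ldots,x_n$, respectively. Let $N$ be the kernel of the morphism $\psi\colon F\to G$ induced by mapping $x_i\mapsto g_i$, $i=1,\ldots,n$. Then $G$ is capable if and only if \[ G \cong \left(F/[N,F]\right)\bigm/ Z\left(F/[N,F]\right).\]
   Context: A group $G$ is capable if there exists a group $H$ such that $G\cong H/Z(H)$, where $Z(H)$ is the center of $H$. The lower central series of a group $K$ is $K_1=K$, $K_{m+1}=[K_m,K]$. The $3$-nilpotent product of groups $A_1,\ldots,A_n$ (each nilpotent of class at most $3$) is $P/P_4$, where $P=A_1*\cdots*A_n$ is the free product; it is the coproduct of the $A_i$ in the variety of nilpotent groups of class at most $3$. $G^{\rm ab}=G/[G,G]$, viewed as a vector space over $\mathbb{F}_p$. For subsets $A,B$ of a group, $[A,B]$ is the subgroup generated by all commutators $[a,b]=a^{-1}b^{-1}ab$ with $a\in A$, $b\in B$. *)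

(* Defs.v *)
(* MathComp, with classical sets: a [groupType] is an arbitrary, possibly
   infinite group, and a [finGroupType] is a finite one. *)
From HB Require Import structures.
From mathcomp Require Import all_boot all_order all_algebra.
From mathcomp Require Import all_fingroup all_solvable.
From mathcomp Require Import boolp classical_sets.

Set Implicit Arguments.
Unset Strict Implicit.
Unset Printing Implicit Defensive.

Local Open Scope group_scope.
Local Open Scope classical_set_scope.
Local Open Scope quotient_scope.

Record is_subgroup (G : groupType) (H : set G) : Prop := IsSubgroup {
  subgroup1 : H 1;
  subgroupM : forall x y, H x -> H y -> H (x * y);
  subgroupV : forall x, H x -> H x^-1 }.

Definition gen_subgroup (G : groupType) (A : set G) : set G :=
  smallest (@is_subgroup G) A.

Definition comm_subgroup (G : groupType) (A B : set G) : set G :=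
  gen_subgroup [set [~ a, b] | a in A & b in B].

Record normalSubgroup (G : groupType) := NormalSubgroup {
  normal_set :> set G;
  normal_subgroup : is_subgroup normal_set;
  normalJ : forall x y, normal_set x -> normal_set (x ^ y) }.

Lemma gen_subgroup_is_subgroup (G : groupType) (A : set G) :
  is_subgroup (gen_subgroup A).
Proof.
split=> [H [HH _]|x y Ax Ay H HA|x Ax H HA]; first exact: subgroup1 HH.
- by apply: (subgroupM HA.1); [apply: Ax | apply: Ay].
- by apply: (subgroupV HA.1); apply: Ax.
Qed.

Lemma setT_is_subgroup (G : groupType) : is_subgroup [set: G].
Proof. by []. Qed.

Definition whole (G : groupType) : normalSubgroup G :=
  NormalSubgroup (setT_is_subgroup G) (fun _ _ _ => I).

Lemma center_is_subgroup (G : groupType) :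
  is_subgroup [set z : G | forall x, commute z x].
Proof.
split=> [x|y z /= yZ zZ x|z /= zZ x]; rewrite /commute.
- by rewrite mul1g mulg1.
- by rewrite -mulgA zZ !mulgA yZ.
- by apply: (mulgI z); rewrite mulKVg mulgA zZ mulgK.
Qed.

Lemma center_normalJ (G : groupType) (z y : G) :
  (forall x, commute z x) -> forall x, commute (z ^ y) x.
Proof. by move=> zZ; rewrite /conjg zZ mulKg. Qed.

Definition gcenter (G : groupType) : normalSubgroup G :=
  NormalSubgroup (center_is_subgroup G) (@center_normalJ G).

Lemma comm_normalJ (G : groupType) (M N : normalSubgroup G) (x y : G) :
  comm_subgroup M N x -> comm_subgroup M N (x ^ y).
Proof.
move=> MNx; have [s1 sM sV] := gen_subgroup_is_subgroup
  [set [~ a, b] | a in (M : set G) & b in (N : set G)].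
apply: (MNx [set x | comm_subgroup M N (x ^ y)]); split.
  split=> [|u v /= Hu Hv|u /= Hu]; first by rewrite /= conj1g.
    by rewrite conjMg; apply: sM.
  by rewrite conjVg; apply: sV.
move=> _ [a Ma [b Nb <-]] /=; rewrite conjRg.
by apply: sub_gen_smallest; exists (a ^ y);
  [exact: normalJ | exists (b ^ y); [exact: normalJ|]].
Qed.

Definition commN (G : groupType) (N M : normalSubgroup G) : normalSubgroup G :=
  NormalSubgroup (gen_subgroup_is_subgroup _) (@comm_normalJ G N M).

(* [lower_central G m] is G_{m+1}: indices are shifted so that G_1 = G is
   [lower_central G 0]. *)
Fixpoint lower_central (G : groupType) (m : nat) : normalSubgroup G :=
  if m is k.+1 then commN (lower_central G k) (whole G) else whole G.

Section Kernel.
Variables (G K : groupType) (f : {multiplicative G -> K}).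

Lemma mult1 : f 1 = 1.
Proof. by apply: (mulgI (f 1)); rewrite -gmulfM !mulg1. Qed.

Lemma multV x : f x^-1 = (f x)^-1.
Proof. by apply: (mulgI (f x)); rewrite -gmulfM !mulgV mult1. Qed.

Lemma ker_is_subgroup : is_subgroup [set x | f x = 1].
Proof.
split=> [|x y /= fx fy|x /= fx]; first exact: mult1.
- by rewrite gmulfM fx fy mulg1.
- by rewrite multV fx invg1.
Qed.

Lemma ker_normalJ x y : f x = 1 -> f (x ^ y) = 1.
Proof. by move=> fx; rewrite /conjg !gmulfM fx mul1g -gmulfM mulVg mult1. Qed.

Definition kernel : normalSubgroup G := NormalSubgroup ker_is_subgroup ker_normalJ.
End Kernel.

Section Quotient.
Variables (G : groupType) (N : normalSubgroup G).

Definition coset_rel (x y : G) : bool := `[< normal_set N (x^-1 * y) >].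

Lemma coset_rel_refl : reflexive coset_rel.
Proof.
by move=> x; apply/asboolP; rewrite mulVg; exact: subgroup1 (normal_subgroup N).
Qed.

Lemma coset_rel_sym : symmetric coset_rel.
Proof.
suff H x y : coset_rel x y -> coset_rel y x by move=> x y; apply/idP/idP; exact: H.
move=> /asboolP Nxy; apply/asboolP.
by have := subgroupV (normal_subgroup N) Nxy; rewrite invgM invgK.
Qed.

Lemma coset_rel_trans : transitive coset_rel.
Proof.
move=> y x z /asboolP Nxy /asboolP Nyz; apply/asboolP.
by have := subgroupM (normal_subgroup N) Nxy Nyz; rewrite mulgA mulgK.
Qed.

Canonical coset_equiv := EquivRel coset_rel
  coset_rel_refl coset_rel_sym coset_rel_trans.

Definition quot := {eq_quot coset_equiv}.
HB.instance Definition _ := Choice.on quot.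

Definition quot_pi (x : G) : quot := \pi_({eq_quot coset_equiv}) x.
Definition quot_repr (u : quot) : G := generic_quotient.repr (u : {eq_quot coset_equiv}).

Lemma quot_reprK u : quot_pi (quot_repr u) = u.
Proof. exact: reprK. Qed.

Lemma quot_pi_eq x y : quot_pi x = quot_pi y <-> normal_set N (x^-1 * y).
Proof.
split=> [/eqquotP /asboolP //|Nxy].
by apply/eqquotP; apply/asboolP.
Qed.

Lemma quot_repr_pi x : normal_set N ((quot_repr (quot_pi x))^-1 * x).
Proof. by apply/quot_pi_eq; rewrite quot_reprK. Qed.

Definition quot_mul u v := quot_pi (quot_repr u * quot_repr v).
Definition quot_inv u := quot_pi (quot_repr u)^-1.

Lemma quot_piM x y : quot_pi (x * y) = quot_mul (quot_pi x) (quot_pi y).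
Proof.
apply/esym/quot_pi_eq; set a := quot_repr _; set b := quot_repr (quot_pi y).
have Nx : normal_set N (a^-1 * x) by exact: quot_repr_pi.
have Ny : normal_set N (b^-1 * y) by exact: quot_repr_pi.
have -> : (a * b)^-1 * (x * y) = (a^-1 * x) ^ b * (b^-1 * y).
  by rewrite /conjg invgM !mulgA mulgK.
exact: (subgroupM (normal_subgroup N) (normalJ b Nx) Ny).
Qed.

Lemma quot_piV x : quot_pi x^-1 = quot_inv (quot_pi x).
Proof.
apply/esym/quot_pi_eq; set a := quot_repr _.
have Nx : normal_set N (a^-1 * x) by exact: quot_repr_pi.
have := normalJ a^-1 (subgroupV (normal_subgroup N) Nx).
by rewrite /conjg invgM !invgK !mulgA mulgK.
Qed.

Lemma quot_mulA : associative quot_mul.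
Proof.
move=> u v w; rewrite -[u]quot_reprK -[v]quot_reprK -[w]quot_reprK.
by rewrite -!quot_piM mulgA.
Qed.

Lemma quot_mul1 : left_id (quot_pi 1) quot_mul.
Proof. by move=> u; rewrite -[u]quot_reprK -quot_piM mul1g. Qed.

Lemma quot_mulr1 : right_id (quot_pi 1) quot_mul.
Proof. by move=> u; rewrite -[u]quot_reprK -quot_piM mulg1. Qed.

Lemma quot_mulV : left_inverse (quot_pi 1) quot_inv quot_mul.
Proof. by move=> u; rewrite -[u]quot_reprK -quot_piV -quot_piM mulVg. Qed.

Lemma quot_mulrV : right_inverse (quot_pi 1) quot_inv quot_mul.
Proof. by move=> u; rewrite -[u]quot_reprK -quot_piV -quot_piM mulgV. Qed.

HB.instance Definition _ := isGroup.Build quot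
  quot_mulA quot_mul1 quot_mulr1 quot_mulV quot_mulrV.

HB.instance Definition _ := isMultiplicative.Build G quot quot_pi quot_piM.

Lemma quot_lift (K : groupType) (f : {multiplicative G -> K}) :
  (forall x, normal_set N x -> f x = 1) ->
  exists h : {multiplicative quot -> K}, forall x, h (quot_pi x) = f x.
Proof.
move=> fN; pose h (u : quot) := f (quot_repr u).
have hE x : h (quot_pi x) = f x.
  have := fN _ (quot_repr_pi x); rewrite gmulfM multV => e.
  by apply: (mulgI (f (quot_repr (quot_pi x)))^-1); rewrite e mulVg.
have hM : {morph h : u v / u * v}.
  by move=> u v; rewrite -[u]quot_reprK -[v]quot_reprK -gmulfM !hE gmulfM.
pose mh := isMultiplicative.Build quot K h hM.
by exists (HB.pack_for {multiplicative quot -> K} h mh).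
Qed.
End Quotient.

Notation "G '//' N" := (@quot G N)
  (at level 40, left associativity) : type_scope.

Definition isomorphic (G H : groupType) : Prop :=
  exists f : {multiplicative G -> H}, bijective f.

(* The witness [H] need not be finite. *)
Definition capable (G : groupType) : Prop :=
  exists H : groupType, isomorphic G (H // gcenter H).

Section FreeProduct.
Variables (I : choiceType) (A : I -> groupType).

Definition letter : choiceType := {i : I & A i}.
Definition word : choiceType := seq letter.
Definition mk_letter (i : I) (a : A i) : letter := Tagged (fun j => A j) a.

(* The smallest congruence on words that identifies a letter 1 with the empty
   word and two adjacent letters of the same factor with their product. *)
Inductive word_eq : word -> word -> Prop :=
| WordRefl u : word_eq u u
| WordSym u v : word_eq u v -> word_eq v u
| WordTrans v u w : word_eq u v -> word_eq v w -> word_eq u w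
| WordCat u u' v v' : word_eq u u' -> word_eq v v' -> word_eq (u ++ v) (u' ++ v')
| WordOne i : word_eq [:: mk_letter (1 : A i)] [::]
| WordMul i (a b : A i) :
    word_eq [:: mk_letter a; mk_letter b] [:: mk_letter (a * b)].

Definition word_rel (u v : word) : bool := `[< word_eq u v >].

Lemma word_rel_refl : reflexive word_rel.
Proof. by move=> u; apply/asboolP; exact: WordRefl. Qed.

Lemma word_rel_sym : symmetric word_rel.
Proof. by move=> u v; apply: asbool_equiv_eq; split=> /WordSym. Qed.

Lemma word_rel_trans : transitive word_rel.
Proof.
by move=> v u w /asboolP uv /asboolP vw; apply/asboolP; exact: WordTrans uv vw.
Qed.

Canonical word_equiv := EquivRel word_rel
  word_rel_refl word_rel_sym word_rel_trans.

Definition freeProduct := {eq_quot word_equiv}.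
HB.instance Definition _ := Choice.on freeProduct.

Definition fp_pi (u : word) : freeProduct := \pi_({eq_quot word_equiv}) u.
Definition fp_repr (x : freeProduct) : word := generic_quotient.repr (x : {eq_quot word_equiv}).

Lemma fp_reprK x : fp_pi (fp_repr x) = x.
Proof. exact: reprK. Qed.

Lemma fp_pi_eq u v : fp_pi u = fp_pi v <-> word_eq u v.
Proof.
split=> [/eqquotP /asboolP //|uv].
by apply/eqquotP; apply/asboolP.
Qed.

Lemma fp_repr_pi u : word_eq (fp_repr (fp_pi u)) u.
Proof. by apply/fp_pi_eq; rewrite fp_reprK. Qed.

Definition letter_inv (l : letter) : letter := mk_letter (tagged l)^-1.
Definition word_inv (u : word) : word := rev (map letter_inv u).

Definition fp_mul x y := fp_pi (fp_repr x ++ fp_repr y).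
Definition fp_inv x := fp_pi (word_inv (fp_repr x)).

Lemma fp_piM u v : fp_pi (u ++ v) = fp_mul (fp_pi u) (fp_pi v).
Proof. by apply/esym/fp_pi_eq; apply: WordCat; exact: fp_repr_pi. Qed.

Lemma letter_mulV l : word_eq [:: letter_inv l; l] [::].
Proof.
case: l => i a; apply: WordTrans (WordOne i).
by rewrite -(mulVg a); exact: WordMul.
Qed.

Lemma letter_mulrV l : word_eq [:: l; letter_inv l] [::].
Proof.
case: l => i a; apply: WordTrans (WordOne i).
by rewrite -(mulgV a); exact: WordMul.
Qed.

Lemma word_mulV u : word_eq (word_inv u ++ u) [::].
Proof.
elim: u => [|l u IH]; first exact: WordRefl.
rewrite /word_inv /= rev_cons -/(word_inv u) cat_rcons.
apply: WordTrans IH; apply: WordCat; first exact: WordRefl.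
by apply: (@WordCat [:: letter_inv l; l] [::] u u);
  [exact: letter_mulV | exact: WordRefl].
Qed.

Lemma word_mulrV u : word_eq (u ++ word_inv u) [::].
Proof.
elim: u => [|l u IH]; first exact: WordRefl.
rewrite /word_inv /= rev_cons -/(word_inv u) -cats1 catA.
apply: WordTrans (letter_mulrV l).
rewrite -[[:: l; _]]/([:: l] ++ ([::] ++ [:: letter_inv l])).
by apply: (WordCat (WordRefl [:: l])); apply: WordCat IH (WordRefl _).
Qed.

Lemma fp_mulA : associative fp_mul.
Proof.
move=> x y z; rewrite -[x]fp_reprK -[y]fp_reprK -[z]fp_reprK.
by rewrite -!fp_piM catA.
Qed.

Lemma fp_mul1 : left_id (fp_pi [::]) fp_mul.
Proof. by move=> x; rewrite -[x]fp_reprK -fp_piM. Qed.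

Lemma fp_mulr1 : right_id (fp_pi [::]) fp_mul.
Proof. by move=> x; rewrite -[x]fp_reprK -fp_piM cats0. Qed.

Lemma fp_mulV : left_inverse (fp_pi [::]) fp_inv fp_mul.
Proof.
move=> x; rewrite -[x in fp_mul _ x]fp_reprK -fp_piM.
by apply/fp_pi_eq; exact: word_mulV.
Qed.

Lemma fp_mulrV : right_inverse (fp_pi [::]) fp_inv fp_mul.
Proof.
move=> x; rewrite -[x in fp_mul x _]fp_reprK -fp_piM.
by apply/fp_pi_eq; exact: word_mulrV.
Qed.

HB.instance Definition _ := isGroup.Build freeProduct
  fp_mulA fp_mul1 fp_mulr1 fp_mulV fp_mulrV.

Definition fp_inj (i : I) (a : A i) : freeProduct := fp_pi [:: mk_letter a].

Lemma fp_injM i : {morph @fp_inj i : a b / a * b}.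
Proof.
move=> a b; rewrite /fp_inj -[RHS]fp_piM.
by apply/fp_pi_eq; exact/WordSym/WordMul.
Qed.

HB.instance Definition _ i :=
  isMultiplicative.Build (A i) freeProduct (@fp_inj i) (@fp_injM i).

Lemma fp_ind (P : freeProduct -> Prop) :
  P 1 -> (forall i (a : A i) x, P x -> P (fp_inj a * x)) -> forall x, P x.
Proof.
move=> P1 PM x; rewrite -[x]fp_reprK; elim: (fp_repr x) => [//|[i a] u IH].
by rewrite -cat1s fp_piM; exact: PM.
Qed.

Lemma fp_lift (K : groupType) (f : forall i, {multiplicative A i -> K}) :
  exists h : {multiplicative freeProduct -> K},
    forall i (a : A i), h (fp_inj a) = f i a.
Proof.
pose ev (u : word) := foldr (fun l k => f (tag l) (tagged l) * k) 1 u.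
have evD u v : ev (u ++ v) = ev u * ev v.
  by elim: u => [|l u IH] /=; rewrite ?mul1g // IH mulgA.
have evE u v : word_eq u v -> ev u = ev v.
  elim=> //= [v' u' w _ -> _ -> //|u1 u2 v1 v2 _ e1 _ e2|i|i a b].
  - by rewrite !evD e1 e2.
  - by rewrite mulg1 mult1.
  - by rewrite !mulg1 gmulfM.
pose h (x : freeProduct) := ev (fp_repr x).
have hE u : h (fp_pi u) = ev u by apply: evE; exact: fp_repr_pi.
have hM : {morph h : x y / x * y} by move=> x y; rewrite [LHS]hE evD.
pose mh := isMultiplicative.Build freeProduct K h hM.
exists (HB.pack_for {multiplicative freeProduct -> K} h mh) => i a /=.
by rewrite hE /= mulg1.
Qed.
End FreeProduct.

(* The [c]-nilpotent product P/P_{c+1} of the groups [A i]. *)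
Definition nilProduct (c : nat) (I : choiceType) (A : I -> groupType) :
    groupType :=
  (freeProduct A // lower_central (freeProduct A) c)%type.

Definition nil_inj (c : nat) (I : choiceType) (A : I -> groupType) (i : I)
    (a : A i) : nilProduct c A :=
  quot_pi _ (fp_inj a).

Lemma lower_central_mult (G K : groupType) (f : {multiplicative G -> K}) m x :
  normal_set (lower_central G m) x -> normal_set (lower_central K m) (f x).
Proof.
elim: m x => [//|m IH] x /= Gx.
have [s1 sM sV] := normal_subgroup (lower_central K m.+1).
apply: (Gx [set x | normal_set (lower_central K m.+1) (f x)]); split.
  split=> [|u v /= Hu Hv|u /= Hu]; first by rewrite /= mult1.
    by rewrite gmulfM; apply: sM.
  by rewrite multV; apply: sV.
move=> _ [a Ga [b _ <-]]; apply: sub_gen_smallest.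
exists (f a); first exact: IH.
by exists (f b) => //; rewrite /commg /conjg !gmulfM !multV.
Qed.

(* The universal property: [nilProduct c A] is the coproduct of the [A i] among
   groups of nilpotency class at most [c]. *)
Lemma nilProduct_universal (c : nat) (I : choiceType) (A : I -> groupType)
    (K : groupType) (f : forall i, {multiplicative A i -> K}) :
  (forall x, normal_set (lower_central K c) x -> x = 1) ->
  exists h : {multiplicative nilProduct c A -> K},
    (forall i (a : A i), h (nil_inj c a) = f i a) /\
    (forall h' : {multiplicative nilProduct c A -> K},
      (forall i (a : A i), h' (nil_inj c a) = f i a) -> h' =1 h).
Proof.
move=> Kc; have [h0 h0E] := fp_lift f.
have [|h hE] := @quot_lift _ (lower_central (freeProduct A) c) _ h0.
  by move=> x /(lower_central_mult h0) /Kc.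
exists h; split=> [i a|h' h'E u]; first by rewrite hE h0E.
rewrite -[u]quot_reprK; elim/fp_ind: (quot_repr u) => [|i a x IH].
  exact: etrans (mult1 h') (esym (mult1 h)).
have -> : quot_pi (lower_central (freeProduct A) c) (fp_inj a * x) =
    (nil_inj c a : nilProduct c A) * quot_pi _ x by exact: quot_piM.
by rewrite !gmulfM h'E hE h0E; congr (_ * _).
Qed.

(* The [i]-th factor is the additive group Z/p (['Z_p], with its group law
   written multiplicatively); [x_gen c p i] is the image of its generator 1. *)
Definition nilProductCyclic (c p n : nat) : groupType :=
  nilProduct c (fun _ : 'I_n => 'Z_p : groupType).

Definition x_gen (c p n : nat) (i : 'I_n) : nilProductCyclic c p n :=
  @nil_inj c _ (fun _ : 'I_n => 'Z_p : groupType) i (Zp1 : 'Z_p).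

(* The linear combination with coefficients [c] of the classes of the [g i] in
   G^ab; the F_p-vector space G^ab is written multiplicatively, so that a scalar
   acts as a power. *)
Definition ab_lincomb (p : nat) (G : finGroupType) (n : nat) (g : 'I_n -> G)
    (c : 'I_n -> 'F_p) : coset_of [set: G]%SET^`(1) :=
  \prod_(i < n) coset [set: G]%SET^`(1) (g i) ^+ (c i : nat).

Definition ab_basis (p : nat) (G : finGroupType) (n : nat) (g : 'I_n -> G) :=
  (forall x, x \in ([set: G]%SET / [set: G]%SET^`(1))%g ->
     exists c : 'I_n -> 'F_p, x = ab_lincomb g c) /\
  (forall c : 'I_n -> 'F_p, ab_lincomb g c = 1 -> forall i, c i = 0%R).

(* Main.v *)
(* Write N for the kernel of psi and Q = F/[N,F].  As N/[N,F] is central in Q,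
   everything reduces to showing that x in F with [x,F] contained in [N,F] lies
   in N.  Let c : H -> G be onto with kernel Z(H), and lift the g_i to h_i in H;
   each h_i^p is central but may be nontrivial, so x_i |-> h_i need not extend
   to F.  Inside a central product of n + 1 copies of H, with all the centers
   identified, the element t_i = (h_i; h_i^-1 in the i-th extra copy) has order
   dividing p, so x_i |-> t_i does extend to a morphism phi on F.  The i-th
   extra coordinate of phi stays in the abelian double centralizer of h_i, hence
   phi kills [N,F], and phi x commutes with phi F.  The leading coordinate of
   phi x then commutes with all h_i, so it is central in H and psi x = 1. *)
Require Import Defs.
From HB Require Import structures.
From mathcomp Require Import all_boot all_order all_algebra.
From mathcomp Require Import all_fingroup all_solvable.
From mathcomp Require Import boolp classical_sets.

Set Implicit Arguments.
Unset Strict Implicit.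
Unset Printing Implicit Defensive.

Section Development.

(** * Generating G from a basis of its abelianization *)

Local Open Scope group_scope.

(** In a p-group the commutator subgroup lies in the Frattini subgroup, whose elements are
    non-generators, so spanning G^ab is enough. *)
Lemma ab_basis_gen (p n : nat) (G : finGroupType) (g : 'I_n -> G) :
    p.-group [set: G] -> ab_basis p g ->
  <<[set g i | i : 'I_n]%SET>> = [set: G].
Proof.
move=> pG [g_span _]; set M := [set g i | i : 'I_n]%SET.
apply: Phi_nongen; apply/eqP; rewrite finset.eqEsubset finset.subsetT /=.
have nG x : x \in 'N([set: G]^`(1)).
  by have /normal_norm/fintype.subsetP-> := der_normal 1 [set: G]; rewrite ?inE.
apply/fintype.subsetP => x _.
have /g_span[c] : coset [set: G]^`(1) x \in [set: G] / [set: G]^`(1).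
  by rewrite mem_quotient ?inE.
pose y := \prod_(i < n) g i ^+ (c i : nat).
have -> : ab_lincomb g c = coset [set: G]^`(1) y.
  rewrite /y morph_prod => [|i _]; last exact: nG.
  by apply: eq_bigr => i _; rewrite morphX ?nG.
move/(rcoset_kercosetP (nG _) (nG _)) => /rcosetP[d dG ->].
rewrite groupM //.
  apply: (fintype.subsetP (joing_subl _ _)).
  by rewrite (Phi_joing pG); apply: (fintype.subsetP (joing_subl _ _)).
apply: group_prod => i _; rewrite groupX //.
by apply: (fintype.subsetP (joing_subr _ _)); exact: imset_f.
Qed.

(** * Subgroups, morphisms and lower central series *)

Local Open Scope classical_set_scope.

Lemma gen_subgroup_sub (G : groupType) (A B : set G) :
  is_subgroup B -> A `<=` B -> gen_subgroup A `<=` B.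
Proof. by move=> sB AB x; apply; split. Qed.

Lemma comm_subgroup_mem (G : groupType) (A B : set G) a b :
  A a -> B b -> comm_subgroup A B [~ a, b].
Proof. by move=> Aa Bb; apply: sub_gen_smallest; exists a => //; exists b. Qed.

Lemma trivial_is_subgroup (G : groupType) : is_subgroup [set (1 : G)].
Proof.
by split=> [//|x y -> ->|x ->]; rewrite /= ?mulg1 ?invg1.
Qed.

Lemma multX (G K : groupType) (f : {multiplicative G -> K}) k :
  {morph f : x / x ^+ k}.
Proof. by move=> x; elim: k => [|k IH]; rewrite ?mult1 // !expgS gmulfM IH. Qed.

Lemma multR (G K : groupType) (f : {multiplicative G -> K}) :
  {morph f : x y / [~ x, y]}.
Proof. by move=> x y; rewrite /commg /conjg !gmulfM !multV. Qed.

Lemma image_is_subgroup (G K : groupType) (f : {multiplicative G -> K})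
    (A : set G) : is_subgroup A -> is_subgroup (f @` A).
Proof.
move=> [A1 AM AV]; split=> [|_ _ [x Ax <-] [y Ay <-]|_ [x Ax <-]].
- by exists 1 => //; exact: mult1.
- by exists (x * y); rewrite ?gmulfM //; exact: AM.
- by exists x^-1; rewrite ?multV //; exact: AV.
Qed.

(** Both entries of a commutator lift along a surjection; this carries class bounds over to
    quotients. *)
Lemma lower_central_surj (G K : groupType) (f : {multiplicative G -> K}) m :
  (forall y, exists x, f x = y) ->
  (lower_central K m : set K) `<=` f @` (lower_central G m : set G).
Proof.
move=> fS; elim: m => [y _|m IH]; first by have [x] := fS y; exists x.
apply: gen_subgroup_sub.
  exact/image_is_subgroup/(normal_subgroup (lower_central G m.+1)).
move=> _ [_ /IH[a Ga <-] [y _ <-]]; have [b <-] := fS y.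
by exists [~ a, b]; [exact: comm_subgroup_mem | exact: multR].
Qed.

(** MathComp counts from ['L_1(G) = G], hence the shift. *)
Lemma lower_central_lcn (G : finGroupType) m :
  (lower_central G m : set G) `<=` [set x | x \in 'L_m.+1([set: G]%SET)].
Proof.
elim: m => [x _|m IH] /=; first by rewrite inE.
apply: gen_subgroup_sub => [|_ [a Ga [b _ <-]]] /=.
  by split=> [|x y Hx Hy|x Hx] /=; rewrite ?group1 ?groupM ?groupV.
by rewrite lcnSn mem_commg ?inE //; exact: IH.
Qed.

(** * Isomorphisms, capability and central quotients *)

Lemma isomorphic_sym (G K : groupType) : isomorphic G K -> isomorphic K G.
Proof.
move=> [f [g fK gK]].
have gM : {morph g : x y / x * y}.
  by move=> x y; apply: (can_inj fK); rewrite gmulfM !gK.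
pose mg := isMultiplicative.Build K G g gM.
by exists (HB.pack_for {multiplicative K -> G} g mg); exists f.
Qed.

Lemma mult_eq (G K : groupType) (f : {multiplicative G -> K}) x y :
  f x = f y <-> f (x^-1 * y) = 1.
Proof.
rewrite gmulfM multV; split=> [->|e]; first by rewrite mulVg.
by apply: (mulgI (f x)^-1); rewrite e mulVg.
Qed.

(** Lift along [f], then apply [k]: equal kernels make the result independent of the lift. *)
Lemma isomorphic_eq_kernel (F G K : groupType) (f : {multiplicative F -> G})
    (k : {multiplicative F -> K}) :
    (forall y, exists x, f x = y) -> (forall y, exists x, k x = y) ->
    (forall x, f x = 1 <-> k x = 1) -> isomorphic G K.
Proof.
move=> /choice[s fs] /choice[t kt] fk.
have eqfk x y : f x = f y <-> k x = k y by rewrite !mult_eq; exact: fk.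
pose h y := k (s y).
have hM : {morph h : x y / x * y}.
  by move=> x y; rewrite /h -gmulfM; apply/eqfk; rewrite gmulfM !fs.
pose mh := isMultiplicative.Build G K h hM.
exists (HB.pack_for {multiplicative G -> K} h mh), (f \o t) => x /=.
  by rewrite -[RHS]fs; apply/eqfk; rewrite kt.
by rewrite -[RHS]kt; apply/eqfk; rewrite fs.
Qed.

(** Composing the projection with the isomorphism trades the quotient for a surjection along which
    elements of [G] lift. *)
Lemma capable_central_ext (G : groupType) : capable G ->
  exists (H : groupType) (c : {multiplicative H -> G}),
    (forall y, exists x, c x = y) /\
    (forall x, c x = 1 <-> forall y, commute x y).
Proof.
move=> [H /isomorphic_sym[f [g fK gK]]].
exists H, (f \o quot_pi (gcenter H)); split=> [y|x].
  by exists (quot_repr (g y)); rewrite /= quot_reprK gK.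
have -> : (forall y, commute x y) <-> quot_pi (gcenter H) x = 1.
  split=> [xZ|/esym/quot_pi_eq]; last by rewrite invg1 mul1g.
  by apply/esym/quot_pi_eq; rewrite invg1 mul1g.
split=> /= [fx|->]; last exact: mult1.
by apply: (can_inj fK); rewrite mult1.
Qed.

Lemma quot_pi_eq1 (G : groupType) (N : normalSubgroup G) x :
  quot_pi N x = 1 <-> normal_set N x.
Proof.
by split=> [/esym/quot_pi_eq|Nx];
  [|apply/esym/quot_pi_eq]; rewrite invg1 mul1g.
Qed.

Lemma quot_pi_commute (G : groupType) (N : normalSubgroup G) x y :
  commute (quot_pi N x) (quot_pi N y) <-> normal_set N [~ x, y].
Proof.
by rewrite -quot_pi_eq1 multR; split=> [/commgP/eqP|/eqP/commgP].
Qed.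

Lemma lower_central_center (G : groupType) m :
  (forall x, normal_set (lower_central G m) x -> forall y, commute x y) ->
  (lower_central G m.+1 : set G) `<=` [set 1].
Proof.
move=> mZ; apply: gen_subgroup_sub; first exact: trivial_is_subgroup.
by move=> _ [a /mZ aZ [b _ <-]]; apply/eqP/commgP.
Qed.

(** * Nilpotent products of cyclic groups *)

Lemma nilProductCyclic_ind (c p n : nat) (P : nilProductCyclic c p n -> Prop) :
  P 1 -> (forall i x, P x -> P (x_gen c p i * x)) -> forall x, P x.
Proof.
move=> P1 PM u; rewrite -[u]quot_reprK.
elim/fp_ind: (quot_repr u) => [//|i a x Px].
set N := lower_central _ _ in Px *.
have -> : quot_pi N (@fp_inj _ (fun=> 'Z_p : groupType) i a * x) =
    x_gen c p i ^+ a * quot_pi N x.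
  rewrite [LHS]gmulfM; congr (_ * _).
  (* Each element of a factor is a natural power of the generator, so inverses need no separate
     case. *)
  have {1}-> : a = (Zp1 : 'Z_p) ^+ (a : nat).
    by apply: val_inj; rewrite /= Zp_expg /= modnMml mul1n modn_small.
  by rewrite (multX (@fp_inj _ (fun=> 'Z_p : groupType) i)) (multX (quot_pi N)).
elim: (a : nat) => [|k IH]; first by rewrite mul1g.
by rewrite expgS -mulgA; exact: PM.
Qed.

Lemma nilProductCyclic_lift (c p n : nat) (K : groupType) (t : 'I_n -> K) :
    (1 < p)%N -> (forall i, t i ^+ p = 1) ->
    (lower_central K c : set K) `<=` [set 1] ->
  exists f : {multiplicative nilProductCyclic c p n -> K},
    forall i, f (x_gen c p i) = t i.
Proof.
move=> p_gt1 tp Kc.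
have modp i k : t i ^+ (k %% (Zp_trunc p).+2) = t i ^+ k.
  (* The modulus built into ['Z_p] is [(Zp_trunc p).+2], which equals [p] because [1 < p]. *)
  rewrite Zp_cast // [in RHS](divn_eq k p) expgnDr mulnC expgnA tp.
  by rewrite expg1n mul1g.
have powM i : {morph (fun a : 'Z_p => t i ^+ (a : nat)) : a b / a * b}.
  by move=> a b /=; rewrite -expgnDr modp.
pose pow i : {multiplicative ('Z_p : groupType) -> K} :=
  HB.pack_for {multiplicative ('Z_p : groupType) -> K}
    (fun a : 'Z_p => t i ^+ (a : nat)) (isMultiplicative.Build _ _ _ (powM i)).
have [f [fE _]] := @nilProduct_universal c 'I_n (fun=> 'Z_p : groupType) K pow Kc.
by exists f => i; rewrite fE /= modn_small ?expg1.
Qed.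

(** * Double centralizers *)

Definition double_cent (G : groupType) (h : G) : set G :=
  [set y | forall w, commute h w -> commute y w].

Lemma double_cent_subgroup (G : groupType) (h : G) :
  is_subgroup (double_cent h).
Proof.
split=> [w _|x y xC yC w hw|x xC w hw]; apply: commute_sym.
- exact: commute1.
- by apply: commuteM; apply: commute_sym; [exact: xC | exact: yC].
- exact/commuteV/commute_sym/xC.
Qed.

Lemma double_cent_id (G : groupType) (h : G) : double_cent h h.
Proof. by []. Qed.

(** Since [h] commutes with itself, [y] centralizes [h], and [x] commutes with everything that
    does. *)
Lemma double_cent_commute (G : groupType) (h x y : G) :
  double_cent h x -> double_cent h y -> commute x y.
Proof. by move=> xC yC; apply: xC; apply/commute_sym/yC. Qed.

(** * The central product of n + 1 copies of H *)

Section Amalgam.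
Variables (H : groupType) (n : nat).

(* Dividing by this central subgroup identifies the center of the leading copy
   of H with the centers of the n others. *)
Definition amalg_set : set (H * {ffun 'I_n -> H})%type :=
  [set u : (H * {ffun 'I_n -> H})%type | (forall j y, commute (u.2 j) y) /\
     u.1 * \prod_(j < n) u.2 j = 1].

Lemma amalg_central u y :
  amalg_set u -> commute u.1 y.
Proof.
move=> [u2 u1]; have -> : u.1 = (\prod_(j < n) u.2 j)^-1.
  by apply: (mulIg (\prod_(j < n) u.2 j)); rewrite mulVg.
apply/commute_sym/commuteV/commute_prod => j _.
exact/commute_sym/u2.
Qed.

Lemma amalg_is_subgroup : is_subgroup amalg_set.
Proof.
split=> [|u v uA vA|u uA].
- split=> [j y|] /=; first by rewrite ffunE; exact/commute_sym/commute1.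
  by rewrite big1 ?mulg1 // => j _; rewrite ffunE.
- split=> [j y|] /=.
    by rewrite ffunE; apply/commute_sym/commuteM; apply/commute_sym;
      [exact: uA.1 | exact: vA.1].
  under eq_bigr do rewrite ffunE.
  rewrite prodgM_commute; last by move=> i j _ _; exact: uA.1.
  by rewrite mulgA -(mulgA u.1) (amalg_central _ vA) mulgA uA.2 mul1g vA.2.
split=> [j y|] /=.
  by rewrite ffunE; apply/commute_sym/commuteV/commute_sym/uA.1.
under eq_bigr do rewrite ffunE.
apply: (mulgI u.1); rewrite mulKVg mulg1.
apply: (mulIg (\prod_j u.2 j)); rewrite uA.2 -prodgM_commute.
  by rewrite big1 // => j _; rewrite mulVg.
by move=> i j _ _; apply/commute_sym/uA.1.
Qed.

(** All coordinates of [u] are central, so conjugation fixes it. *)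
Lemma amalg_normalJ u v : amalg_set u -> amalg_set (u ^ v).
Proof.
move=> uA; suff -> : u ^ v = u by [].
suff uv : commute u v by rewrite /conjg uv mulKg.
congr (_, _); first exact: amalg_central.
by apply/ffunP=> j; rewrite !ffunE; exact: uA.1.
Qed.

Definition amalg : normalSubgroup (H * {ffun 'I_n -> H})%type :=
  NormalSubgroup amalg_is_subgroup amalg_normalJ.

Lemma ffun_expg (a : {ffun 'I_n -> H}) k j : (a ^+ k) j = a j ^+ k.
Proof. by elim: k => [|k IH]; rewrite ?ffunE // !expgS ffunE IH. Qed.

Definition root_corr (h : H) (i : 'I_n) : (H * {ffun 'I_n -> H})%type :=
  (h, [ffun j => if j == i then h^-1 else 1]).

(** The p-th power has [h ^+ p] and [h ^- p] as its nontrivial coordinates: they are central with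
    product 1, so it dies in the quotient. *)
Lemma root_corr_exp h i p :
  (forall y, commute (h ^+ p) y) -> quot_pi amalg (root_corr h i) ^+ p = 1.
Proof.
move=> hpZ; rewrite -multX; apply/quot_pi_eq1.
have E1 : (root_corr h i ^+ p).1 = h ^+ p by exact: (multX fst).
have E2 j : (root_corr h i ^+ p).2 j = if j == i then h ^- p else 1.
  rewrite (multX snd) ffun_expg ffunE; case: eqP => _; last exact: expg1n.
  exact: expVgn.
split=> [j y|].
  rewrite E2; case: eqP => _; apply: commute_sym; last exact: commute1.
  exact/commuteV/commute_sym.
rewrite E1 (big_only1 i) ?E2 ?eqxx ?mulgV // => j /negPf ji _.
by rewrite E2 ji.
Qed.

(** The bound holds coordinatewise in the direct product and passes to the quotient. *)
Lemma lower_central_amalg m :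
  (lower_central H m : set H) `<=` [set 1] ->
  (lower_central ((H * {ffun 'I_n -> H}) // amalg)%type m : set _) `<=` [set 1].
Proof.
move=> Hm y /(@lower_central_surj _ _ (quot_pi amalg) m)[|u um <-].
  by move=> z; exists (quot_repr z); exact: quot_reprK.
rewrite /= (_ : u = 1) ?mult1 //.
pose ev j : {multiplicative {ffun 'I_n -> H} -> H} :=
  HB.pack_for {multiplicative {ffun 'I_n -> H} -> H}
   (fun a : {ffun 'I_n -> H} => a j) (isMultiplicative.Build _ _ _
    ((fun a b => ffunE _ _) : {morph (fun a : {ffun 'I_n -> H} => a j) : a b / a * b})).
rewrite [u]surjective_pairing; congr (_, _).
  exact/Hm/(lower_central_mult fst).
apply/ffunP=> j; rewrite ffunE.
exact: Hm (lower_central_mult (ev j) (lower_central_mult snd um)).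
Qed.

End Amalgam.

(** * The morphism psi and its kernel *)

Lemma ab_basis_psi_surj (c p n : nat) (G : finGroupType) (g : 'I_n -> G)
    (psi : {multiplicative nilProductCyclic c p n -> G}) :
    p.-group [set: G]%SET -> ab_basis p g ->
    (forall i, psi (x_gen c p i) = g i) ->
  forall y, exists x, psi x = y.
Proof.
move=> pG g_basis psi_x y.
have im_psi := image_is_subgroup psi (setT_is_subgroup _).
(* The image of [psi] as a finite set: a group containing every [g i], hence all of [G]. *)
pose A := [set z | `[< range psi z >]]%SET.
have gA : group_set A.
  apply/group_setP; split=> [|a b]; rewrite !inE; first exact: (subgroup1 im_psi).
  exact: (subgroupM im_psi).
have : <<[set g i | i : 'I_n]%SET>> \subset Group gA.
  rewrite gen_subG; apply/fintype.subsetP => _ /imsetP[i _ ->].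
  by rewrite !inE; exists (x_gen c p i).
rewrite (ab_basis_gen pG g_basis) => /fintype.subsetP/(_ y).
by rewrite !inE => /(_ isT)[x _ <-]; exists x.
Qed.

Section CapableGroup.
Variables (p n : nat) (G : finGroupType) (g : 'I_n -> G).
Variable psi : {multiplicative nilProductCyclic 3 p n -> G}.
Hypotheses (p_gt1 : (1 < p)%N) (g_exp : forall i, g i ^+ p = 1).
Hypothesis G_class :
  forall x, normal_set (lower_central G 2) x -> x = 1.
Hypothesis psi_x : forall i, psi (x_gen 3 p i) = g i.
Hypothesis psi_surj : forall y, exists x, psi x = y.

Let F := nilProductCyclic 3 p n.

Lemma capable_central_kernel (x : F) : capable G ->
    (forall y : F, normal_set (commN (kernel psi) (whole F)) [~ x, y]) ->
  psi x = 1.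
Proof.
move=> /capable_central_ext[H [c [/choice[s cs] cZ]]] xN.
pose h i := s (g i).
have ch i : c (h i) = g i by exact: cs.
have hpZ i y : commute (h i ^+ p) y by apply/cZ: y; rewrite multX ch.
(* The third term of the series of [H] maps to that of [G], which is trivial; so it is central and
   the fourth term vanishes. *)
have H3 : (lower_central H 3 : set H) `<=` [set 1].
  apply: lower_central_center => u /(lower_central_mult c)/G_class cu.
  exact/cZ.
have [phi phi_x] := nilProductCyclic_lift p_gt1
  (fun i => root_corr_exp i (hpZ i)) (lower_central_amalg (n := n) H3).
(* Both constraints on the representative [v] hold for the [root_corr (h i) i] and survive
   products. *)
have phiE (u : F) : exists v : H * {ffun 'I_n -> H},
    [/\ phi u = quot_pi (amalg H n) v, c v.1 = psi u
       & forall j, double_cent (h j) (v.2 j)].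
  elim/nilProductCyclic_ind: u => [|i u [v [phiu cv vC]]].
    exists 1; split=> [||j]; rewrite ?mult1 //= ffunE.
    exact: subgroup1 (double_cent_subgroup _).
  exists (root_corr (h i) i * v); split=> [||j].
  - by rewrite !gmulfM phiu phi_x.
  - by rewrite [in RHS]gmulfM psi_x -ch -cv -gmulfM.
  have [C1 CM CV] := double_cent_subgroup (h j).
  rewrite /= !ffunE; apply: CM; last exact: vC.
  by case: eqP => [<-|_] //; apply: CV; exact: double_cent_id.
(* For [a] in the kernel of [psi], the representatives commute already in the direct product: [u.1]
   is central and the other coordinates share an abelian double centralizer. *)
have NF1 : (commN (kernel psi) (whole F) : set F) `<=` kernel phi.
  apply: gen_subgroup_sub; first exact: ker_is_subgroup.
  move=> _ [a psi_a [b _ <-]].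
  have [u [phia cu uC]] := phiE a; have [v [phib _ vC]] := phiE b.
  have uZ : forall y, commute u.1 y by apply/cZ; rewrite cu.
  rewrite /= multR phia phib; apply/eqP/commgP; rewrite /commute -!gmulfM.
  congr (quot_pi _ _); congr (_, _); first exact: uZ.
  by apply/ffunP=> j; rewrite !ffunE; exact: double_cent_commute (uC j) (vC j).
have [u [phix <- uC]] := phiE x; apply/cZ => k.
have [y psi_y] := psi_surj (c k).
have [v [phiy cv vC]] := phiE y.
have : normal_set (amalg H n) [~ u, v].
  apply/quot_pi_commute; rewrite -phix -phiy.
  by apply/commgP/eqP; rewrite -multR; exact: NF1.
(* The extra coordinates of [[~ u, v]] are trivial, so the product condition forces [[~ u.1, v.1] =
   1]. *)
move=> [_]; rewrite big1 ?mulg1 => [/eqP/commgP uv|j _]; last first.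
  rewrite (multR snd) /= /commg /conjg !ffunE.
  exact/eqP/commgP/(double_cent_commute (uC j) (vC j)).
(* [k] and [v.1] have the same image under [c], so they differ by a central factor. *)
rewrite -(mulKVg v.1 k); apply: commuteM; first exact: uv.
have zZ : forall y, commute (v.1^-1 * k) y.
  by apply/cZ; rewrite gmulfM multV cv psi_y mulVg.
exact/commute_sym/zZ.
Qed.

End CapableGroup.

End Development.

Theorem theorem2p2 (p : nat) (p_prime : prime p) (p_odd : odd p)
  (G : finGroupType)
  (G_noncyclic : ~~ cyclic [set: G])
  (G_nilpotent : nilpotent [set: G]) (G_class : (nil_class [set: G] <= 2)%N)
  (G_exponent : exponent [set: G] = p)
  (n : nat) (g : 'I_n -> G) (g_basis : ab_basis p g)
  (psi : {multiplicative nilProductCyclic 3 p n -> G})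
  (psi_x : forall i : 'I_n, psi (x_gen 3 p i) = g i) :
  let F := nilProductCyclic 3 p n in
  let N := kernel psi in
  let Q := (F // commN N (whole F))%type in
  capable G <-> isomorphic G (Q // gcenter Q)%type.
Proof.
(* For the converse, [Q] itself witnesses capability. *)
move=> F N Q; split=> [capG|]; last by exists Q.
have pG : (p.-group [set: G])%g by rewrite -pnat_exponent G_exponent pnat_id.
have p_gt1 := prime_gt1 p_prime.
have g_exp i : (g i ^+ p)%g = 1%g by rewrite -G_exponent expg_exponent ?inE.
have G_class2 x : normal_set (lower_central G 2) x -> x = 1%g.
  move/lower_central_lcn => /=.
  by rewrite (lcn_nil_classP 2 G_nilpotent G_class) => /set1P.
have psi_surj := ab_basis_psi_surj pG g_basis psi_x.
pose f1 := quot_pi (commN N (whole F)); pose f2 := quot_pi (gcenter Q).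
apply: (isomorphic_eq_kernel (f := psi) (k := f2 \o f1)) => //.
  by move=> y; exists (quot_repr (quot_repr y)); rewrite /= !quot_reprK.
(* An element dies in Q/Z(Q) exactly when its commutators with F lie in [N,F]; this must
   characterize N. *)
move=> x; rewrite quot_pi_eq1; split=> [Nx y|xZ].
  rewrite -[y]quot_reprK; apply/quot_pi_commute.
  exact: comm_subgroup_mem.
apply: (capable_central_kernel p_gt1 g_exp G_class2 psi_x psi_surj capG) => y.
by apply/quot_pi_commute; exact: xZ.
Qed.
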